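(* Let $[(G_1,\Sigma_1),(G_2,\Sigma_2)]$ be a $1$-separation of a signed graph $(G,\Sigma)$ and let $v$ be the vertex in $V(G_1)\cap V(G_2)$. Then $$ \begin{aligned} \mathcal{I}(G,\Sigma)\cong{} & [\mathcal{I}((G_1,\Sigma_1)-v)+\mathcal{I}((G_2,\Sigma_2)-v)+\{(1,1)\}]\\ &\cup[\mathcal{I}(G_1,\Sigma_1)+\mathcal{I}(G_2,\Sigma_2)]\\ &\cup[\mathcal{I}((G_1,\Sigma_1)_E)+\mathcal{I}((G_2,\Sigma_2)_O)]\\ &\cup[\mathcal{I}((G_1,\Sigma_1)_O)+\mathcal{I}((G_2,\Sigma_2)_E)]. \end{aligned} $$
   Context: A signed graph is a pair $(G,\Sigma)$, where $G=(V,E)$ is a finite graph (parallel edges and loops are permitted) with $V=\{1,\ldots,n\}$ and $\Sigma\subseteq E$. Edges in $\Sigma$ are called odd, the other edges of $E$ even. $S(G,\Sigma)$ denotes the set of all symmetric $n\times n$ real matrices $A=[a_{i,j}]$ such that for all $i,j$ ($i=j$ allowed, in which case edges connecting $i$ and $j$ are loops at $i$): if $a_{i,j}<0$, then there is an even edge connecting $i$ and $j$; if $a_{i,j}>0$, then there is an odd edge connecting $i$ and $j$; if $a_{i,j}=0$, then either there are both an odd edge and an even edge connecting $i$ and $j$, or there are no edges connecting $i$ and $j$. For a signed graph with another finite vertex set, matrices are indexed by that vertex set (listed in some order); for the empty vertex set, $S$ consists of the $0\times 0$ matrix. For a symmetric real matrix $A$, $\mathrm{pin}(A)=(p,q)$,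 where $p$ and $q$ are the numbers of positive and negative eigenvalues of $A$ (counted with multiplicity); for the $0\times 0$ matrix this is $(0,0)$. The inertia set of $(G,\Sigma)$ is $\mathcal{I}(G,\Sigma)=\{\mathrm{pin}(A)\mid A\in S(G,\Sigma)\}$. A separation of a graph $G$ is a pair $(G_1,G_2)$ of subgraphs with $G_1\cup G_2=G$ and $E(G_1)\cap E(G_2)=\emptyset$; it is a $k$-separation if $|V(G_1)\cap V(G_2)|=k$. A $k$-separation $[(G_1,\Sigma_1),(G_2,\Sigma_2)]$ of a signed graph $(G,\Sigma)$ is a $k$-separation $(G_1,G_2)$ of $G$ with $\Sigma_i=\Sigma\cap E(G_i)$. For $i=1,2$: $(G_i,\Sigma_i)_E$ and $(G_i,\Sigma_i)_O$ are the signed graphs obtained from $(G_i,\Sigma_i)$ by adding at $v$ an even loop and an odd loop, respectively; $(G_i,\Sigma_i)-v$ is obtained from $(G_i,\Sigma_i)$ by deleting the vertex $v$. Here $\mathbb{N}$ includes $0$. For $\mathcal{S},\mathcal{R}\subseteq\mathbb{N}^2$, write $\mathcal{S}\leq\mathcal{R}$ if for each $(p,q)\in\mathcal{S}$ there exists $(r,s)\in\mathcal{R}$ with $r\leq p$ and $s\leq q$; write $\mathcal{R}\cong\mathcal{S}$ if $\mathcal{S}\leq\mathcal{R}$ and $\mathcal{R}\leq\mathcal{S}$. (Equivalently, $\mathcal{R}$ and $\mathcal{S}$ have the same minimal pairs in the componentwise order.) Further, $\mathcal{R}+\mathcal{S}=\{(p_1+p_2,q_1+q_2)\mid(p_1,q_1)\in\mathcal{R},(p_2,q_2)\in\mathcal{S}\}$.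 *)

(* Defs.v *)
From mathcomp Require Import classical_sets reals.
From mathcomp Require Import all_boot all_order all_algebra.
From mathcomp Require Import polyrcf.
Set Implicit Arguments.
Unset Strict Implicit.
Unset Printing Implicit Defensive.
Import Order.TTheory GRing.Theory Num.Theory.
Local Open Scope ring_scope.

(* Multigraphs, possibly with loops, whose vertices and edges are taken in    *)
(* ambient finite types, so that subgraphs, unions and intersections are set  *)
(* operations. The set [ends e] is a singleton exactly when [e] is a loop;    *)
(* its value is irrelevant for [e] outside [edges].                           *)
Record mgraph (V E : finType) := MGraph {
  verts : {set V};
  edges : {set E};
  ends : E -> {set V};
  endsP : forall e, e \in edges ->
    (ends e \subset verts) && (0 < #|ends e| <= 2)%N
}.

Record sgraph (V E : finType) := SGraph {
  ground :> mgraph V E;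
  oddE : {set E};
  oddE_sub : oddE \subset edges ground
}.

Section SignedGraphs.
Variables V E : finType.
Implicit Types (H K : mgraph V E) (G : sgraph V E) (v x y : V).

Definition evenE G : {set E} := edges G :\: oddE G.

(* For [x = y] this says that [e] is a loop at [x]. *)
Definition connects H (e : E) x y : bool :=
  (e \in edges H) && (ends H e == [set x; y]).

Definition even_adj G x y : bool := [exists e in evenE G, connects G e x y].
Definition odd_adj G x y : bool := [exists e in oddE G, connects G e x y].
Definition adj G x y : bool := [exists e, connects G e x y].

Definition subgraph K H : Prop :=
  [/\ verts K \subset verts H, edges K \subset edges H
    & {in edges K, ends K =1 ends H}].

Definition separation H H1 H2 : Prop :=
  [/\ subgraph H1 H, subgraph H2 H,
      verts H1 :|: verts H2 = verts H,
      edges H1 :|: edges H2 = edges H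
    & edges H1 :&: edges H2 = set0].

Definition k_separation (k : nat) H H1 H2 : Prop :=
  separation H H1 H2 /\ #|verts H1 :&: verts H2| = k.

Definition signed_k_separation (k : nat) (G G1 G2 : sgraph V E) : Prop :=
  [/\ k_separation k G G1 G2,
      oddE G1 = oddE G :&: edges G1
    & oddE G2 = oddE G :&: edges G2].

Lemma del_vertex_endsP H v e :
  e \in [set e in edges H | v \notin ends H e] ->
  (ends H e \subset verts H :\ v) && (0 < #|ends H e| <= 2)%N.
Proof.
by rewrite inE => /andP[/endsP/andP[sub ->] ve]; rewrite subsetD1 sub ve.
Qed.

Definition del_vertex_ground H v : mgraph V E :=
  MGraph (@del_vertex_endsP H v).

Lemma del_vertex_odd_sub G v :
  oddE G :&: edges (del_vertex_ground G v) \subset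
  edges (del_vertex_ground G v).
Proof. exact: subsetIr. Qed.

Definition del_vertex G v : sgraph V E := SGraph (@del_vertex_odd_sub G v).

(* The new loop at [v] is the edge [None]. The vertex set is written          *)
(* [v |: verts H] only to make the operation total: it is [verts H] as soon   *)
(* as [v] is a vertex of [H].                                                 *)
Definition loop_ends H v (e : option E) : {set V} :=
  if e is Some e' then ends H e' else [set v].

Lemma add_loop_endsP H v e :
  e \in None |: [set Some e' | e' in edges H] ->
  (loop_ends H v e \subset v |: verts H) && (0 < #|loop_ends H v e| <= 2)%N.
Proof.
case/setU1P=> [->|/imsetP[e' /endsP/andP[sub card] ->]] /=.
  by rewrite cards1 sub1set setU11.
by rewrite card (subset_trans sub) // subsetUr.
Qed.

Definition add_loop_ground H v : mgraph V (option E) :=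
  MGraph (@add_loop_endsP H v).

Lemma add_even_loop_odd_sub G v :
  [set Some e | e in oddE G] \subset edges (add_loop_ground G v).
Proof. by apply: subsetU; rewrite imsetS ?oddE_sub ?orbT. Qed.

Lemma add_odd_loop_odd_sub G v :
  None |: [set Some e | e in oddE G] \subset edges (add_loop_ground G v).
Proof. by rewrite setUS // imsetS // oddE_sub. Qed.

Definition add_even_loop G v : sgraph V (option E) :=
  SGraph (@add_even_loop_odd_sub G v).

Definition add_odd_loop G v : sgraph V (option E) :=
  SGraph (@add_odd_loop_odd_sub G v).

End SignedGraphs.

Section Inertia.
Variable R : realType.

Local Open Scope classical_set_scope.

(* Rows and columns are indexed by [verts G], listed by [enum_val]. *)
Definition S_mx (V E : finType) (G : sgraph V E) : set 'M[R]_#|verts G| :=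
  [set A | A^T = A /\
    forall i j : 'I_#|verts G|,
      let x := enum_val i in let y := enum_val j in
      [/\ A i j < 0 -> even_adj G x y,
          A i j > 0 -> odd_adj G x y
        & A i j = 0 -> (even_adj G x y /\ odd_adj G x y) \/ ~~ adj G x y]].

(* [rootsR] lists the distinct real roots of a nonzero polynomial, and        *)
(* [mup x p] is the multiplicity of [x] as a root of [p].                     *)
Definition pin (n : nat) (A : 'M[R]_n) : nat * nat :=
  (\sum_(x <- rootsR (char_poly A) | (0 < x)%R) mup x (char_poly A),
   \sum_(x <- rootsR (char_poly A) | (x < 0)%R) mup x (char_poly A))%N.

Definition inertia_set (V E : finType) (G : sgraph V E) : set (nat * nat) :=
  [set pin A | A in @S_mx V E G].

End Inertia.

Arguments S_mx R {V E} G _.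

Section PairSets.
Implicit Types A B : set (nat * nat).

Local Open Scope classical_set_scope.

Definition pair_le A B : Prop :=
  forall p, A p -> exists2 r, B r & (r.1 <= p.1)%N /\ (r.2 <= p.2)%N.

Definition pair_equiv A B : Prop := pair_le B A /\ pair_le A B.

Definition pair_sum A B : set (nat * nat) :=
  [set (p.1 + q.1, p.2 + q.2)%N | p in A & q in B].

End PairSets.

Declare Scope pair_set_scope.
Delimit Scope pair_set_scope with pairs.
Infix "+" := pair_sum : pair_set_scope.
Infix "`|`" := (@classical_sets.setU (nat * nat)) : pair_set_scope.
Notation "A ~= B" := (pair_equiv A B) (at level 70, no associativity)
  : pair_set_scope.

(* Main.v *)
Require Import Defs.
From mathcomp Require Import all_boot all_order all_algebra.
From mathcomp Require Import classical_sets reals.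
From mathcomp Require Import polyrcf complex ring lra.

(** Work with quadratic forms on the vertex set: a matrix of [S_mx R G],
    padded with zeros, is a symmetric function on pairs of vertices whose
    signs fit [G], and padding does not change the inertia
    ([inertia_setP]). The inertia of real symmetric matrices is used only
    through three facts. It does not increase under a compression
    [M A M^T] ([pin_congr]); it is subadditive ([pin_add]); and it is
    superadditive on two compressions that are orthogonal for [A]
    ([pin_orthogonal]). All three follow from the spectral theorem and a
    dimension count for diagonal forms ([card_pos_le]).

    Let [f] realize [G], and let [A] be its restriction to the vertices other
    than [v], a form that splits as [F1 + F2] along the separation; [f] is [A]
    bordered by the row [b] of [v] and by the diagonal entry [a].

    If [b] is not in the row space of [A], then bordering adds a hyperbolic
    plane, so that the inertia grows by exactly [(1, 1)]
    ([pin_border_nrange_ge], [pin_border_le]); this is the term with [v]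
    deleted.

    If [b = x A], then the bordered form is congruent to the direct sum of [A]
    and the Schur complement [t = a - b x^T]. Both [b] and [t] split along
    the separation, and [a] splits as [d1 + d2] with [d1], [d2] fitting the
    loops at [v] on either side. Moving [c = d1 - b1 x^T] from the first
    diagonal entry to the second makes the first Schur complement vanish and
    the second equal to [t], so the two bordered pieces have total inertia at
    most that of [f] ([split_attained]). The sign of [c] decides the term: no
    new loops for [c = 0], an even loop on the first piece and an odd loop on
    the second for [c > 0], the opposite for [c < 0].

    Conversely, realizations of the two pieces are added. When loops were
    introduced, the second piece is first rescaled so that the two
    contributions of the new loops at [v] cancel ([glue_attained]). *)

Set Implicit Arguments.
Unset Strict Implicit.
Unset Printing Implicit Defensive.
Import Order.TTheory GRing.Theory Num.Theory.
Local Open Scope ring_scope.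

(** * Pairs of natural numbers *)

Definition le2 (p q : nat * nat) := (p.1 <= q.1)%N && (p.2 <= q.2)%N.
Definition add2 (p q : nat * nat) := (p.1 + q.1, p.2 + q.2)%N.

Lemma le2_refl p : le2 p p.
Proof. by rewrite /le2 !leqnn. Qed.

Lemma le2_trans q p r : le2 p q -> le2 q r -> le2 p r.
Proof.
move=> /andP[pq1 pq2] /andP[qr1 qr2].
by rewrite /le2 (leq_trans pq1 qr1) (leq_trans pq2 qr2).
Qed.

Lemma le2_anti p q : le2 p q -> le2 q p -> p = q.
Proof.
case: p q => [a b] [c d] /andP[/= ac bd] /andP[/= ca db].
by congr (_, _); apply/anti_leq/andP.
Qed.

Lemma le2_add p q p' q' : le2 p p' -> le2 q q' -> le2 (add2 p q) (add2 p' q').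
Proof. by move=> /andP[? ?] /andP[? ?]; rewrite /le2 /= !leq_add. Qed.

Lemma add2A : associative add2.
Proof. by move=> p q r; rewrite /add2 /= !addnA. Qed.

(** * Inertia of real symmetric matrices *)

Section Spectral.
Local Open Scope sesquilinear_scope.

Lemma hermitian_diagonalization (C : numClosedFieldType) n (A : 'M[C]_n) :
  A \is hermsymmx ->
  exists (U : 'M[C]_n) (e : 'rV[C]_n),
  [/\ U *m U^t* = 1%:M, U^t* *m U = 1%:M, A = U^t* *m diag_mx e *m U
    & forall i, e 0 i \is Num.real].
Proof.
move=> hA; have uU := spectral_unitarymx A.
exists (spectralmx A), (spectral_diag A); split.
- exact/unitarymxP.
- by rewrite -invmx_unitary // mulVmx // unitarymx_unit.
- rewrite -invmx_unitary //.
  exact/orthomx_spectralP/hermitian_normalmx.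
- by move=> i; apply: (mxOverP (hermitian_spectral_diag_real hA)).
Qed.

Lemma unitary_conjK (C : numClosedFieldType) n (U D : 'M[C]_n) :
  U *m U^t* = 1%:M -> U *m (U^t* *m D *m U) *m U^t* = D.
Proof. by move=> UV; rewrite !mulmxA UV mul1mx -mulmxA UV mulmx1. Qed.

Section Inertia.
Variable R : realType.
Local Notation C := (complex R).
Local Notation toC := (map_mx (real_complex R)).
Definition sign_count n (d : 'rV[R]_n) : nat * nat :=
  (#|[set i | 0 < d 0 i]|, #|[set i | d 0 i < 0]|).

(** Links the definition of [pin] to a count of diagonal entries: for a split
    polynomial the multiplicities of the roots satisfying [P] add up to the
    number of linear factors whose root satisfies [P]. *)
Lemma sum_mup_prod_XsubC (s : seq R) (P : pred R) :
  (\sum_(x <- rootsR (\prod_(y <- s) ('X - y%:P)) | P x)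
     mup x (\prod_(y <- s) ('X - y%:P)) = count P s)%N.
Proof.
set p := \prod_(y <- s) _.
have p0 : p != 0 by rewrite monic_neq0 // monic_prod_XsubC.
rewrite -sum1_count [RHS]big_mkcond /=.
under eq_bigr => x _.
  rewrite mu_prod_XsubC -sum1_count big_mkcond /=; over.
rewrite exchange_big /= !big_seq; apply: eq_bigr => y ys.
have yr : y \in rootsR p.
  rewrite /rootsR -(roots_on_rootsR p0) ?inE //=.
  by rewrite root_prod_XsubC.
rewrite big_mkcond (bigD1_seq y) ?uniq_roots //= eqxx big1 ?addn0 //.
by move=> x /negbTE xy; rewrite eq_sym xy; case: ifP.
Qed.

(** The diagonalizing matrix is unitary over the complex numbers and not
    orthogonal over the reals, because the complex spectral theorem then
    suffices: only the real diagonal matters for the inertia, and forms may be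
    compared through complex compressions. *)
Lemma real_spectral n (A : 'M[R]_n) : A^T = A ->
  exists (U : 'M[C]_n) (d : 'rV[R]_n),
  [/\ U *m U^t* = 1%:M, U^t* *m U = 1%:M
    & toC A = U^t* *m diag_mx (toC d) *m U].
Proof.
move=> symA.
have rA : toC A \is a realmx.
  by apply/mxOverP => i j; rewrite mxE; apply/complex_realP; exists (A i j).
have hA : toC A \is hermsymmx.
  apply: realsym_hermsym rA; apply/is_hermitianmxP.
  by rewrite expr0 scale1r map_mx_id // map_trmx symA.
have [U [e [UV VU AE re]]] := hermitian_diagonalization hA.
exists U, (\row_i complex.Re (e 0 i)); split; [exact: UV|exact: VU|].
suff -> : toC (\row_i complex.Re (e 0 i)) = e by [].
by apply/rowP => i; rewrite !mxE RRe_real.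
Qed.

Lemma pin_spectral n (A : 'M[R]_n) (U V : 'M[C]_n) d :
  V *m U = 1%:M -> toC A = V *m diag_mx (toC d) *m U -> pin A = sign_count d.
Proof.
move=> VU AE.
have pA : char_poly A = \prod_(y <- [seq d 0 i | i <- enum 'I_n]) ('X - y%:P).
  apply: (map_poly_inj (real_complex R)).
  rewrite map_char_poly AE.
  have -> : char_poly (V *m diag_mx (toC d) *m U) = char_poly (diag_mx (toC d)).
    set D := diag_mx _; rewrite /char_poly /char_poly_mx.
    pose P (B : 'M[C]_n) := map_mx (@polyC C) B.
    have PVU : P V *m P U = 1%:M by rewrite /P -map_mxM VU map_mx1.
    have -> : 'X%:M - P (V *m D *m U) = P V *m ('X%:M - P D) *m P U.
      rewrite /P mulmxBr mulmxBl !map_mxM; congr (_ - _).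
      by rewrite scalar_mxC -mulmxA PVU mulmx1.
    by rewrite !det_mulmx mulrC mulrA -det_mulmx (mulmx1C PVU) det1 mul1r.
  rewrite char_poly_trig; last exact/diag_mx_is_trig.
  rewrite rmorph_prod /= big_map enumT; apply: eq_bigr => i _.
  by rewrite rmorphB /= map_polyX map_polyC /= !mxE eqxx mulr1n.
rewrite /pin /sign_count pA !sum_mup_prod_XsubC !count_map !cardE.
by congr (_, _); rewrite -size_filter; congr size; rewrite /enum_mem -!enumT;
 apply: eq_filter => i /=; rewrite ?inE.
Qed.

(** Sylvester's argument. Suppose that [z], supported on the positive entries of
    [d'], is mapped by [M] to a vector vanishing on the positive entries of
    [d]. Then the form of [d'] at [z] is both nonnegative, vanishing only for
    [z = 0], and nonpositive. Hence the corresponding submatrix of [M] has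
    independent rows, and its number of columns bounds its number of rows. *)
Lemma card_pos_le m n (M : 'M[C]_(m, n)) (d : 'rV[R]_n) (d' : 'rV[R]_m) :
  diag_mx (toC d') = M *m diag_mx (toC d) *m M^t* ->
  (#|[set i | (0 < d' 0 i)%R]| <= #|[set i | (0 < d 0 i)%R]|)%N.
Proof.
move=> E.
set P' := [set i | 0 < d' 0 i]; set P := [set i | 0 < d 0 i].
pose N := mxsub (@enum_val _ (mem P')) (@enum_val _ (mem P)) M.
suff: row_free N by move=> /eqP rN; rewrite -[X in (X <= _)%N]rN rank_leq_col.
apply: inj_row_free => z zN.
have diagE k (f : 'rV[R]_k) (y : 'rV[C]_k) :
  (y *m diag_mx (toC f) *m y^t*) 0 0 = \sum_i (f 0 i)%:C%C * `|y 0 i| ^+ 2.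
  rewrite !mxE; apply: eq_bigr => i _.
  by rewrite mul_mx_diag !mxE normCK mulrAC mulrC.
pose w := z *m rowsub (@enum_val _ (mem P')) 1%:M.
have wE i : w 0 i = \sum_(k | enum_val k == i) z 0 k.
  rewrite !mxE [RHS]big_mkcond /=; apply: eq_bigr => k _.
  by rewrite !mxE; case: ifP => _; rewrite ?mulr1 ?mulr0.
have wP k : w 0 (enum_val k) = z 0 k.
  rewrite wE (bigD1 k) //= big1 ?addr0 // => l /andP[/eqP/enum_val_inj->].
  by rewrite eqxx.
have wN i : i \notin P' -> w 0 i = 0.
  move=> iP; rewrite wE big1 // => k /eqP ki.
  by move: (enum_valP k) iP; rewrite ki => ->.
have wM i : i \in P -> (w *m M) 0 i = 0.
  move=> iP; rewrite -mulmxA mul_rowsub_mx mul1mx.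
  have /rowP/(_ (enum_rank_in iP i)) := zN.
  rewrite !mxE => zN0; rewrite -[RHS]zN0; apply: eq_bigr => k _; rewrite !mxE.
  by rewrite enum_rankK_in.
have le1 : \sum_i (d' 0 i)%:C%C * `|w 0 i| ^+ 2 <= 0 :> C.
  rewrite -diagE E.
  have -> : w *m (M *m diag_mx (toC d) *m M^t* ) *m w^t* =
      w *m M *m diag_mx (toC d) *m (w *m M)^t*.
    by rewrite (trmx_mul w) map_mxM !mulmxA.
  rewrite diagE sumr_le0 // => i _.
  have [iP|] := boolP (i \in P); first by rewrite wM // normr0 expr0n mulr0.
  rewrite inE -leNgt => di; rewrite mulr_le0_ge0 // ?exprn_ge0 //.
  by rewrite (lecR _ 0).
have ge1 i : 0 <= (d' 0 i)%:C%C * `|w 0 i| ^+ 2 :> C.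
  have [iP|iP] := boolP (i \in P'); last by rewrite wN // normr0 expr0n mulr0.
  by rewrite mulr_ge0 ?exprn_ge0 // ler0c ltW //; rewrite inE in iP.
apply/rowP => k; rewrite [RHS]mxE -wP.
have /eqP : \sum_i (d' 0 i)%:C%C * `|w 0 i| ^+ 2 = 0 :> C.
  by apply/eqP; rewrite eq_le le1 sumr_ge0.
rewrite psumr_eq0; last by move=> i _; apply: ge1.
move=> /allP/(_ (enum_val k)).
rewrite mem_index_enum mulf_eq0 expf_eq0 normr_eq0 /= => /(_ isT).
case/orP => [|/eqP//]; have := enum_valP k; rewrite inE => dk.
by rewrite (fmorph_eq0 (real_complex R)) gt_eqF.
Qed.

(** The bound on negative entries is the bound on positive ones for the opposite
    forms. *)
Lemma sign_count_le m n (M : 'M[C]_(m, n)) (d : 'rV[R]_n) (d' : 'rV[R]_m) :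
  diag_mx (toC d') = M *m diag_mx (toC d) *m M^t* ->
  le2 (sign_count d') (sign_count d).
Proof.
move=> E; rewrite /le2 (card_pos_le E) /=.
have E' : diag_mx (toC (- d')) = M *m diag_mx (toC (- d)) *m M^t*.
  have dN k (f : 'rV[R]_k) : diag_mx (toC (- f)) = - diag_mx (toC f).
    by rewrite map_mxN raddfN.
  by rewrite !dN mulmxN mulNmx -E.
have negE k (f : 'rV[R]_k) :
    [set i | (f 0 i < 0)%R] = [set i | (0 < (- f) 0 i)%R].
  by apply/setP => i; rewrite !inE mxE oppr_gt0.
by rewrite !negE (card_pos_le E').
Qed.

Lemma sign_count_row m n (d : 'rV[R]_m) (e : 'rV[R]_n) :
  sign_count (row_mx d e) = add2 (sign_count d) (sign_count e).
Proof.
have cnt (P : pred R) : #|[set i | P (row_mx d e ord0 i)]| =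
    (#|[set i | P (d ord0 i)]| + #|[set i | P (e ord0 i)]|)%N.
  rewrite -!sum1dep_card big_split_ord /=.
  by congr (_ + _)%N; apply: eq_bigl => i; rewrite ?row_mxEl ?row_mxEr.
by rewrite /sign_count /add2 (cnt (fun x => 0 < x)) (cnt (fun x => x < 0)).
Qed.

Lemma sign_count_le_pin m n (A : 'M[R]_n) (M : 'M[C]_(m, n)) d : A^T = A ->
  diag_mx (toC d) = M *m toC A *m M^t* -> le2 (sign_count d) (pin A).
Proof.
move=> /real_spectral[U [e [_ VU AE]]]; rewrite (pin_spectral VU AE) AE => dE.
apply: (@sign_count_le _ _ (M *m U^t* )).
by rewrite dE trmx_mul map_mxM trmxCK !mulmxA.
Qed.

Lemma pin_le_sign_count m n (A : 'M[R]_n) (M : 'M[C]_(n, m)) d : A^T = A ->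
  toC A = M *m diag_mx (toC d) *m M^t* -> le2 (pin A) (sign_count d).
Proof.
move=> /real_spectral[U [e [UV VU AE]]]; rewrite (pin_spectral VU AE) AE => dE.
apply: (@sign_count_le _ _ (U *m M)).
by rewrite -[diag_mx (toC e)](unitary_conjK _ UV) dE trmx_mul map_mxM !mulmxA.
Qed.

Lemma map_real_trC m n (M : 'M[R]_(m, n)) : (toC M)^t* = toC M^T.
Proof. by apply/matrixP => i j; rewrite !mxE; apply: conjc_real. Qed.

Lemma pin_congr m n (M : 'M[R]_(m, n)) (A : 'M[R]_n) : A^T = A ->
  le2 (pin (M *m A *m M^T)) (pin A).
Proof.
move=> sA; have sB : (M *m A *m M^T)^T = M *m A *m M^T.
  by rewrite !trmx_mul trmxK sA mulmxA.
have [U [e [UV VU BE]]] := real_spectral sB.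
rewrite (pin_spectral VU BE); apply: (@sign_count_le_pin _ _ _ (U *m toC M)) => //.
rewrite trmx_mul map_mxM map_real_trC.
have -> : U *m toC M *m toC A *m (toC M^T *m U^t* ) =
          U *m toC (M *m A *m M^T) *m U^t* by rewrite !map_mxM !mulmxA.
by rewrite BE unitary_conjK.
Qed.

Lemma pin_add n (A B : 'M[R]_n) : A^T = A -> B^T = B ->
  le2 (pin (A + B)) (add2 (pin A) (pin B)).
Proof.
move=> sA sB.
have [U [d [_ VU AE]]] := real_spectral sA.
have [U' [d' [_ VU' BE]]] := real_spectral sB.
rewrite (pin_spectral VU AE) (pin_spectral VU' BE) -sign_count_row.
apply: (@pin_le_sign_count _ _ _ (row_mx (U^t* ) (U'^t* ))); 
  first by rewrite raddfD /= sA sB.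
rewrite map_mxD AE BE map_row_mx diag_mx_row mul_row_block !mulmx0 addr0 add0r.
by rewrite tr_row_mx map_col_mx mul_row_col !trmxCK.
Qed.

(** Two families of vectors that are orthogonal for [A], each diagonalizing its
    own compression, together form a compression of [A] to a diagonal form. *)
Lemma pin_orthogonal m1 m2 n (M1 : 'M[R]_(m1, n)) (M2 : 'M[R]_(m2, n))
    (A : 'M[R]_n) : A^T = A -> M1 *m A *m M2^T = 0 ->
  le2 (add2 (pin (M1 *m A *m M1^T)) (pin (M2 *m A *m M2^T))) (pin A).
Proof.
move=> sA M12.
have sB m (M : 'M[R]_(m, n)) : (M *m A *m M^T)^T = M *m A *m M^T.
  by rewrite !trmx_mul trmxK sA mulmxA.
have M21 : M2 *m A *m M1^T = 0.
  by apply: trmx_inj; rewrite !trmx_mul trmxK sA mulmxA M12 trmx0.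
have [U [d [UV VU AE]]] := real_spectral (sB _ M1).
have [U' [d' [UV' VU' BE]]] := real_spectral (sB _ M2).
rewrite (pin_spectral VU AE) (pin_spectral VU' BE) -sign_count_row.
apply: (@sign_count_le_pin _ _ _ (col_mx (U *m toC M1) (U' *m toC M2))) => //.
rewrite map_row_mx diag_mx_row mul_col_mx tr_col_mx map_row_mx mul_col_row.
rewrite !trmx_mul !map_mxM !map_real_trC.
have E k l (X : 'M[C]_k) (M : 'M[R]_(k, n)) (Y : 'M[C]_l) (N : 'M[R]_(l, n)) :
    X *m toC M *m toC A *m (toC N^T *m Y) = X *m toC (M *m A *m N^T) *m Y.
  by rewrite !map_mxM !mulmxA.
by rewrite !E AE BE M12 M21 !map_mx0 !mulmx0 !mul0mx !unitary_conjK.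
Qed.

Lemma pin_diag n (d : 'rV[R]_n) : pin (diag_mx d) = sign_count d.
Proof.
apply: (@pin_spectral _ _ 1%:M 1%:M); first exact: mulmx1.
by rewrite mul1mx mulmx1 map_diag_mx.
Qed.

End Inertia.

End Spectral.

(** * Inertia of a bordered matrix *)

Section Border.
Variables (R : realType) (n : nat).
Implicit Types (A : 'M[R]_n) (b e x y : 'rV[R]_n) (a c t : R).

Lemma pin0 m : pin (0 : 'M[R]_m) = (0, 0)%N.
Proof.
have -> : (0 : 'M[R]_m) = diag_mx 0 by rewrite raddf0.
rewrite pin_diag /sign_count.
have -> : [set i : 'I_m | 0 < (0 : 'rV[R]_m) 0 i] = finset.set0.
  by apply/setP => i; rewrite !inE mxE ltxx.
have -> : [set i : 'I_m | (0 : 'rV[R]_m) 0 i < 0] = finset.set0.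
  by apply/setP => i; rewrite !inE mxE ltxx.
by rewrite cards0.
Qed.

Lemma pin_scale c A : A^T = A -> 0 < c -> le2 (pin (c *: A)) (pin A).
Proof.
move=> sA c0; have -> : c *: A = (Num.sqrt c)%:M *m A *m ((Num.sqrt c)%:M)^T.
  by rewrite tr_scalar_mx mul_scalar_mx mul_mx_scalar scalerA -expr2 sqr_sqrtr ?ltW.
exact: pin_congr.
Qed.

Lemma pin_hyperbolic :
  pin (block_mx 1%:M 0 0 (-1)%:M : 'M[R]_(1 + 1)) = (1, 1)%N.
Proof.
have <- : diag_mx (row_mx (const_mx 1) (const_mx (-1))) =
    block_mx 1%:M 0 0 (-1)%:M :> 'M[R]_(1 + 1).
  by rewrite diag_mx_row !diag_const_mx.
rewrite pin_diag sign_count_row /sign_count.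
have cc c : #|[set i : 'I_1 | (0 < (const_mx c : 'rV[R]_1) 0 i)%R]| = (0 < c)%R.
  rewrite -sum1dep_card big_mkcond big_ord1 mxE; by case: ifP.
have cc' c : #|[set i : 'I_1 | ((const_mx c : 'rV[R]_1) 0 i < 0)%R]| = (c < 0)%R.
  rewrite -sum1dep_card big_mkcond big_ord1 mxE; by case: ifP.
by rewrite !cc !cc' ltr01 ltr10 ltrN10 ltr0N1.
Qed.

(** When [e] is a unit vector killed by [A] and orthogonal to [b], this is [A]
    completed at the coordinate [e] by the row [b] and the diagonal entry [a]. *)
Definition border A e b a := A + b^T *m e + e^T *m b + a *: (e^T *m e).

Lemma border_sym A e b a : A^T = A -> (border A e b a)^T = border A e b a.
Proof.
move=> sA; rewrite /border !raddfD /= !trmx_mul !trmxK sA linearZ /=.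
by rewrite trmx_mul trmxK; congr (_ + _); rewrite addrAC.
Qed.

(** The border [u^T e + e^T u], with half of [a e] absorbed in [u], is the
    difference of the squares of [u + e / 2] and [u - e / 2], hence has inertia
    at most [(1, 1)]. *)
Lemma pin_border_le A e b a : A^T = A ->
  le2 (pin (border A e b a)) (add2 (pin A) (1, 1)%N).
Proof.
move=> sA; pose u := b + (a / 2) *: e; pose h := 2^-1 : R.
pose K := block_mx 1%:M 0 0 (-1)%:M : 'M[R]_(1 + 1).
pose M := row_mx (u + h *: e)^T (u - h *: e)^T : 'M[R]_(n, 1 + 1).
have sK : K^T = K by rewrite tr_block_mx !tr_scalar_mx !trmx0.
have -> : border A e b a = A + M *m K *m M^T.
  rewrite /border -!addrA; congr (_ + _).
  rewrite /M /K mul_row_block tr_row_mx mul_row_col !trmxK !mulmx0 addr0 add0r.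
  rewrite !mulmx1 mul_mx_scalar scaleN1r.
  apply/matrixP => i j; rewrite !mxE !big_ord1 !mxE /h; by field.
rewrite -pin_hyperbolic; apply: le2_trans (pin_add _ _) (le2_add (le2_refl _) _) => //.
  by rewrite !trmx_mul trmxK sK mulmxA.
exact: pin_congr.
Qed.

(** Completing the square: bordering by [b = x A] is a compression of [A] by
    [1 + e^T x], plus the Schur complement placed at [e]. *)
Lemma pin_border_range_le A e b a x : A^T = A -> b = x *m A ->
  le2 (pin (border A e b a))
      (add2 (pin A) (pin ((a - (b *m x^T) 0 0)%:M : 'M_1))).
Proof.
move=> sA bE; set t := a - _.
have -> : border A e b a =
    (1%:M + e^T *m x) *m A *m (1%:M + e^T *m x)^T + e^T *m t%:M *m e^T^T.
  have bxE : b *m x^T = ((b *m x^T) 0 0)%:M by apply: mx11_scalar.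
  have bT : b^T = A *m x^T by rewrite bE trmx_mul sA.
  rewrite raddfD /= trmx1 trmx_mul trmxK mulmxDl mul1mx -mulmxA -bE.
  rewrite mulmxDr mulmx1 mulmxDl mulmxA -bT -(mulmxA e^T b) (mulmxA b) bxE.
  rewrite mul_scalar_mx -scalemxAr -(mulmxA e^T) mul_scalar_mx -scalemxAr.
  rewrite /t scalerBl /border -!addrA; congr (_ + _); rewrite addrCA; congr (_ + _).
  by congr (_ + _); rewrite addrCA subrr addr0.
have s1 : (t%:M : 'M_1)^T = t%:M by rewrite tr_scalar_mx.
have sM m k (M : 'M[R]_(m, k)) B : B^T = B -> (M *m B *m M^T)^T = M *m B *m M^T.
  by move=> sB; rewrite !trmx_mul trmxK sB mulmxA.
by apply: le2_trans (pin_add _ _) (le2_add _ _); rewrite ?sM //; apply: pin_congr.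
Qed.

Section Lower.
Variables (A : 'M[R]_n) (e b : 'rV[R]_n) (a : R).
Hypotheses (sA : A^T = A) (ee : e *m e^T = 1%:M) (eA : e *m A = 0)
  (be : b *m e^T = 0).
Let B := border A e b a.

Let Ae : A *m e^T = 0.
Proof. by apply: trmx_inj; rewrite trmx_mul trmxK sA eA trmx0. Qed.

Let eb : e *m b^T = 0.
Proof. by apply: trmx_inj; rewrite trmx_mul trmxK be trmx0. Qed.

Let eB : e *m B = b + a *: e.
Proof.
rewrite /B /border !mulmxDr -scalemxAr !mulmxA eA eb ee mul0mx !mul1mx.
by rewrite !add0r.
Qed.

Lemma border_compress : (1%:M - e^T *m e) *m B = A + b^T *m e.
Proof.
rewrite mulmxBl mul1mx -mulmxA eB mulmxDr -scalemxAr /B /border.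
by rewrite -(addrA (A + b^T *m e)) addrK.
Qed.

(** The vector [y = e - x'], where [x'] is [x] with its component along [e]
    removed, is orthogonal for the bordered form to the complement of [e], and
    the form takes at [y] the value of the Schur complement. *)
Lemma pin_border_range_ge x : b = x *m A ->
  le2 (add2 (pin A) (pin ((a - (b *m x^T) 0 0)%:M : 'M_1))) (pin B).
Proof.
move=> bE; set t := a - _.
pose x' := x - (x *m e^T) *m e; pose y := e - x'.
have bxE : x *m b^T = ((b *m x^T) 0 0)%:M.
  by rewrite -[LHS]trmxK trmx_mul trmxK [in LHS](mx11_scalar (b *m _))
    tr_scalar_mx.
have x'E k (C : 'M[R]_(n, k)) : x' *m C = x *m C - x *m e^T *m (e *m C).
  by rewrite mulmxBl mulmxA.
have x'e : x' *m e^T = 0 by rewrite x'E ee mulmx1 subrr.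
have x'A : x' *m A = b by rewrite x'E eA mulmx0 subr0.
have x'b : x' *m b^T = x *m b^T by rewrite x'E eb mulmx0 subr0.
have yB : y *m B = t *: e.
  rewrite mulmxBl eB /B /border !mulmxDr -scalemxAr !mulmxA x'A x'b x'e.
  by rewrite !mul0mx scaler0 !addr0 bxE mul_scalar_mx /t scalerBl opprD addrACA
    subrr add0r.
have ye : y *m e^T = 1%:M by rewrite mulmxBl ee x'e subr0.
have ey : e *m y^T = 1%:M.
  by apply: trmx_inj; rewrite trmx_mul trmxK ye trmx1.
have By : B *m y^T = t *: e^T.
  by apply: trmx_inj; rewrite trmx_mul trmxK border_sym // yB linearZ /= trmxK.
have Pe : (1%:M - e^T *m e) *m e^T = 0.
  by rewrite mulmxBl mul1mx -mulmxA ee mulmx1 subrr.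
have := @pin_orthogonal R n 1 n (1%:M - e^T *m e) y B (border_sym _ _ _ sA).
rewrite -mulmxA By -scalemxAr Pe scaler0 => /(_ erefl).
rewrite border_compress yB -scalemxAl ey scalemx1.
rewrite raddfB /= trmx1 trmx_mul trmxK mulmxBr mulmx1 mulmxDl !mulmxA Ae mul0mx.
by rewrite add0r -(mulmxA b^T) ee mulmx1 addrK.
Qed.

(** A vector [y] in the kernel of [A] with [b y^T = 1] satisfies [y B = e], so
    [y] and [f = e - (a / 2) y] are isotropic with product [1]: they span a
    hyperbolic plane. Subtracting [b^T y] makes the complement of [e]
    orthogonal to that plane without changing the form there. *)
Lemma pin_border_nrange_ge : ~~ (b <= A)%MS ->
  le2 (add2 (pin A) (1, 1)%N) (pin B).
Proof.
move=> bA.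
have [y [yA yb ye]] : exists y, [/\ y *m A = 0, b *m y^T = 1%:M & y *m e^T = 0].
  have : b *m cokermx A != 0 by rewrite -submxE.
  case/rV0Pn => j bj.
  pose y0 := (col j (cokermx A))^T; pose c := (b *m cokermx A) 0 j.
  have y0A : y0 *m A = 0.
    apply: trmx_inj; rewrite trmx_mul trmxK sA colE.
    by rewrite mulmxA mulmx_coker mul0mx trmx0.
  have by0 : b *m y0^T = c%:M.
    by rewrite trmxK colE mulmxA -colE [LHS]mx11_scalar mxE.
  pose y1 := c^-1 *: y0.
  have y1E k (X : 'M[R]_(n, k)) :
      (y1 - (y1 *m e^T) *m e) *m X = y1 *m X - y1 *m e^T *m (e *m X).
    by rewrite mulmxBl mulmxA.
  have y1A : y1 *m A = 0 by rewrite -scalemxAl y0A scaler0.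
  have y1b : y1 *m b^T = 1%:M.
    apply: trmx_inj; rewrite trmx_mul trmxK linearZ /= -scalemxAr by0.
    by rewrite scale_scalar_mx mulVf // trmx1.
  exists (y1 - (y1 *m e^T) *m e); split.
  - by rewrite y1E y1A eA mulmx0 subr0.
  - apply: trmx_inj; rewrite trmx_mul trmxK y1E eb mulmx0 subr0.
    by rewrite y1b trmx1.
  - by rewrite y1E ee mulmx1 subrr.
have by1 : y *m b^T = 1%:M by apply: trmx_inj; rewrite trmx_mul trmxK yb trmx1.
have ey : e *m y^T = 0 by apply: trmx_inj; rewrite trmx_mul trmxK ye trmx0.
have sB := border_sym e b a sA.
have yB : y *m B = e.
  rewrite /B /border !mulmxDr -scalemxAr !mulmxA yA by1 ye.
  by rewrite !mul0mx scaler0 !addr0 add0r mul1mx.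
pose f := e - (a / 2) *: y.
have fB : f *m B = b + (a / 2) *: e.
  rewrite mulmxBl eB -scalemxAl yB -addrA -scalerBl; congr (_ + _ *: _); by field.
have By : B *m y^T = e^T by apply: trmx_inj; rewrite trmx_mul trmxK sB yB trmxK.
have Bf : B *m f^T = b^T + (a / 2) *: e^T.
  by apply: trmx_inj; rewrite trmx_mul trmxK sB fB raddfD /= linearZ /= !trmxK.
have fT : f^T = e^T - (a / 2) *: y^T by rewrite raddfB /= linearZ.
have ef : e *m f^T = 1%:M by rewrite fT mulmxBr -scalemxAr ee ey scaler0 subr0.
have bf : b *m f^T = - (a / 2)%:M.
  by rewrite fT mulmxBr -scalemxAr be yb scalemx1 sub0r.
have form h k : (y + h *: f) *m B *m (y + k *: f)^T = (h + k)%:M.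
  have -> : (y + k *: f)^T = y^T + k *: f^T by rewrite raddfD /= linearZ.
  have -> : (y + h *: f) *m B = e + h *: (b + (a / 2) *: e).
    by rewrite mulmxDl -scalemxAl yB fB.
  rewrite mulmxDr -scalemxAr !mulmxDl -!scalemxAl !mulmxDl -!scalemxAl.
  rewrite ey yb ef bf; apply/matrixP => i j; rewrite !mxE !ord1 /=; by field.
pose h := 2^-1 : R.
pose M1 := 1%:M - e^T *m e - b^T *m y.
pose M2 := col_mx (y + h *: f) (y + (- h) *: f).
have M1e : M1 *m e^T = 0.
  by rewrite !mulmxBl mul1mx -!mulmxA ee ye mulmx1 mulmx0 subrr subr0.
have M1b : M1 *m b^T = 0.
  by rewrite !mulmxBl mul1mx -!mulmxA eb by1 mulmx1 mulmx0 subr0 subrr.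
have M1B : M1 *m B = A.
  by rewrite mulmxBl border_compress -mulmxA yB addrK.
have M1f k : M1 *m B *m (y + k *: f)^T = 0.
  have -> : (y + k *: f)^T = y^T + k *: f^T by rewrite raddfD /= linearZ.
  rewrite -mulmxA mulmxDr -scalemxAr By Bf mulmxDr -scalemxAr mulmxDr -scalemxAr.
  by rewrite M1e M1b !(scaler0, addr0).
have := @pin_orthogonal R n (1 + 1) n M1 M2 B sB.
have -> : M1 *m B *m M2^T = 0.
  by rewrite tr_col_mx mul_mx_row !M1f row_mx0.
move=> /(_ erefl); rewrite M1B.
have -> : A *m M1^T = A.
  apply: trmx_inj; rewrite trmx_mul trmxK sA !mulmxBl mul1mx -!mulmxA eA yA.
  by rewrite !mulmx0 !subr0.
rewrite tr_col_mx mul_col_mx mul_col_row !form.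
have -> : h + h = 1 by rewrite /h; by field.
have -> : - h + - h = -1 by rewrite /h; by field.
by rewrite subrr addNr raddf0 pin_hyperbolic.
Qed.

End Lower.
End Border.

(** * Sign conditions and forms on a vertex set *)

(** The sign condition on an entry between two vertices, in terms of whether an
    even edge ([ev]) and an odd edge ([od]) join them. The four cases describe
    the negative numbers, the positive numbers, zero, and all numbers. *)
Definition fits (R : realType) (ev od : bool) (r : R) : bool :=
  if ev then od || (r < 0) else if od then 0 < r else r == 0.

Section Fits.
Variable R : realType.
Implicit Types (r s c : R) (ev od : bool).

Lemma fits_add ev od ev' od' r s : fits ev od r -> fits ev' od' s ->
  fits (ev || ev') (od || od') (r + s).
Proof.
rewrite /fits; case: ev ev' od od' => -[] [] [] //=; try lra.
by move=> /eqP-> /eqP->; rewrite addr0.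
Qed.

Lemma fits_scale ev od c r : 0 < c -> fits ev od (c * r) = fits ev od r.
Proof.
by move=> c0; rewrite /fits pmulr_rlt0 // pmulr_rgt0 // mulf_eq0 gt_eqF.
Qed.

Lemma fits_witness ev od : fits ev od (od%:R - ev%:R : R).
Proof.
case: ev od => -[] //=;
by rewrite /fits /= ?subr0 ?sub0r ?subrr ?ltrN10 ?ltr01 ?eqxx.
Qed.

(** The sets described by [fits] are convex cones, and the cone of a union of
    edge sets is the sum of the cones. When the two
    cones are the opposite half-lines, [`|r| + 1] is large enough for one summand
    to have either sign while the other compensates. *)
Lemma fits_split ev od ev' od' r : fits (ev || ev') (od || od') r ->
  exists s t, [/\ r = s + t, fits ev od s & fits ev' od' t].
Proof.
have w (e e' o o' : bool) : (e && o) -> exists s t,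
    [/\ r = s + t, fits e o s & fits e' o' t].
  move=> /andP[e1 o1]; exists (r - (o'%:R - e'%:R)), (o'%:R - e'%:R); split.
  - by rewrite subrK.
  - by rewrite /fits e1 o1.
  - exact: fits_witness.
have [eo _|eo] := boolP (ev && od); first exact: w.
have [eo' _|eo'] := boolP (ev' && od').
  have [t [s [rE fs ft]]] := w ev' ev od' od eo'.
  by exists s, t; rewrite addrC.
have [n1 n2] : - `|r| - 1 < 0 /\ 0 < r + `|r| + 1.
  by have := ler_norm (- r); rewrite normrN; have := normr_ge0 r; split; lra.
have [n3 n4] : r - `|r| - 1 < 0 /\ 0 < `|r| + 1.
  by have := ler_norm r; have := normr_ge0 r; split; lra.
rewrite /fits; case: ev ev' od od' eo eo' => -[] [] [] //= _ _ r0.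
- by exists (r / 2), (r / 2); split; lra.
- by exists (- `|r| - 1), (r + `|r| + 1); split=> //; ring.
- by exists r, 0; rewrite addr0.
- by exists (`|r| + 1), (r - `|r| - 1); split=> //; ring.
- by exists 0, r; rewrite add0r.
- by exists (r / 2), (r / 2); split; lra.
- by exists r, 0; rewrite addr0.
- by exists 0, r; rewrite add0r.
- by exists r, 0; rewrite addr0.
Qed.
End Fits.

Section Forms.
Variables (R : realType) (V : finType).
Implicit Types (f g : V -> V -> R) (b : V -> R) (S : {set V}) (ev od : rel V).

Definition realizes ev od f :=
  (forall x y, f x y = f y x) /\ forall x y, fits (ev x y) (od x y) (f x y).

Lemma realizes_add ev od ev' od' f g : realizes ev od f -> realizes ev' od' g ->
  realizes (fun x y => ev x y || ev' x y) (fun x y => od x y || od' x y)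
    (fun x y => f x y + g x y).
Proof.
move=> [sf ff] [sg fg]; split=> x y; first by rewrite sf sg.
exact: fits_add.
Qed.

Lemma realizes_scale ev od f c : 0 < c -> realizes ev od f ->
  realizes ev od (fun x y => c * f x y).
Proof.
move=> c0 [sf ff]; split=> x y; first by rewrite sf.
by rewrite fits_scale.
Qed.

Definition form_mx f : 'M[R]_#|V| :=
  \matrix_(i, j) f (enum_val i) (enum_val j).
Definition vec_row b : 'rV[R]_#|V| := \row_i b (enum_val i).

Lemma form_mx_sym f : (forall x y, f x y = f y x) -> (form_mx f)^T = form_mx f.
Proof. by move=> sf; apply/matrixP => i j; rewrite !mxE sf. Qed.

Lemma sum_delta S (g : V -> R) x :
  \sum_(i < #|S|) (x == enum_val i)%:R * g (enum_val i) =
  if x \in S then g x else 0.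
Proof.
rewrite -(big_enum_val (fun y => (x == y)%:R * g y)) /=.
case: ifP => xS.
  rewrite (bigD1 x) //= eqxx mul1r big1 ?addr0 // => y /andP[_ /negbTE yx].
  by rewrite eq_sym yx mul0r.
rewrite big1 // => y yS; case: eqP => [xy|]; last by rewrite mul0r.
by rewrite xy yS in xS.
Qed.

Lemma sum_delta_ord S (c : 'I_#|S| -> R) k :
  \sum_i (enum_val k == enum_val i)%:R * c i = c k.
Proof.
rewrite (bigD1 k) //= eqxx mul1r big1 ?addr0 // => i /negbTE ik.
by rewrite (inj_eq enum_val_inj) eq_sym ik mul0r.
Qed.

Lemma sum_deltaT (g : V -> R) x :
  \sum_(i < #|V|) (x == enum_val i)%:R * g (enum_val i) = g x.
Proof.
rewrite -(big_enum_val (fun y => (x == y)%:R * g y)) /=.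
rewrite (bigD1 x) //= eqxx mul1r big1 ?addr0 // => y /negbTE yx.
by rewrite eq_sym yx mul0r.
Qed.

(** A form vanishing off [S] and its matrix indexed by [S] are compressions of
    each other through the incidence matrix of [S] in [V]. *)
Lemma pin_form_mx S f : (forall x y, f x y = f y x) ->
  (forall x y, x \notin S -> f x y = 0) ->
  pin (\matrix_(i, j) f (enum_val i) (enum_val j) : 'M[R]_#|S|) =
  pin (form_mx f).
Proof.
move=> sf f0; set A := \matrix_(i, j) _.
have f0' x y : y \notin S -> f x y = 0 by move=> yS; rewrite sf f0.
have sA : A^T = A by apply/matrixP => i j; rewrite !mxE sf.
pose Q : 'M[R]_(#|S|, #|V|) := \matrix_(i, k) (enum_val i == enum_val k)%:R.
apply: le2_anti.
  have -> : A = Q *m form_mx f *m Q^T; last exact/pin_congr/form_mx_sym.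
  have QF i k : (Q *m form_mx f) i k = f (enum_val i) (enum_val k).
    rewrite !mxE -(sum_deltaT (fun x => f x (enum_val k))).
    by apply: eq_bigr => l _; rewrite !mxE.
  apply/matrixP => i j; rewrite [RHS]mxE [LHS]mxE -(sum_deltaT (f (enum_val i))).
  by apply: eq_bigr => k _; rewrite QF !mxE mulrC.
have -> : form_mx f = Q^T *m A *m Q^T^T; last exact: pin_congr.
have QA k j : (Q^T *m A) k j = f (enum_val k) (enum_val j).
  transitivity (if enum_val k \in S then f (enum_val k) (enum_val j) else 0).
    rewrite -(sum_delta _ (fun x => f x (enum_val j))) !mxE.
    by apply: eq_bigr => l _; rewrite !mxE eq_sym.
  by case: ifPn => // /f0->.
apply/matrixP => k l; rewrite [RHS]mxE [LHS]mxE.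
transitivity (if enum_val l \in S then f (enum_val k) (enum_val l) else 0).
  by case: ifPn => // /f0'->.
rewrite -sum_delta trmxK.
by apply: eq_bigr => j _; rewrite QA !mxE mulrC eq_sym.
Qed.

End Forms.

Section FormAlgebra.
Variables (R : realType) (V : finType).
Implicit Types (f g : V -> V -> R) (b : V -> R).

Lemma eq_form_mx f g : (forall x y, f x y = g x y) -> form_mx f = form_mx g.
Proof. by move=> fg; apply/matrixP => i j; rewrite !mxE. Qed.

Lemma form_mxD f g : form_mx (fun x y => f x y + g x y) = form_mx f + form_mx g.
Proof. by apply/matrixP => i j; rewrite !mxE. Qed.

Lemma form_mxZ c f : form_mx (fun x y => c * f x y) = c *: form_mx f.
Proof. by apply/matrixP => i j; rewrite !mxE. Qed.

Lemma vec_row_mul0 b f : (forall x y, b x * f x y = 0) ->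
  vec_row b *m form_mx f = 0.
Proof.
by move=> bf; apply/rowP => j; rewrite !mxE big1 // => i _; rewrite !mxE.
Qed.

Lemma vec_row_dot b b' :
  vec_row b *m (vec_row b')^T = (\sum_x b x * b' x)%:M.
Proof.
rewrite [LHS]mx11_scalar !mxE; congr _%:M.
rewrite [RHS](big_enum_val (fun x => b x * b' x)).
by apply: eq_bigr => i _; rewrite !mxE.
Qed.

Definition border_form (v : V) f b (a : R) x y :=
  f x y + b x * (y == v)%:R + (x == v)%:R * b y + a * ((x == v)%:R * (y == v)%:R).

Lemma border_formE v f b a : form_mx (border_form v f b a) =
  border (form_mx f) (vec_row (fun x => (x == v)%:R)) (vec_row b) a.
Proof. by apply/matrixP => i j; rewrite !mxE !big_ord1 !mxE. Qed.

Definition attained (ev od : rel V) (p : nat * nat) :=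
  exists2 f : V -> V -> R, realizes ev od f & pin (form_mx f) = p.

Lemma attained_ext ev od ev' od' p : ev =2 ev' -> od =2 od' ->
  attained ev od p <-> attained ev' od' p.
Proof.
move=> evE odE; split=> -[f [sf ff] fp]; exists f => //; split=> // x y.
  by rewrite -evE -odE.
by rewrite evE odE.
Qed.

End FormAlgebra.

(** * Gluing forms at a vertex *)

Definition del_rel (V : eqType) (v : V) (r : rel V) : rel V :=
  fun x y => [&& r x y, x != v & y != v].
(** The boolean [a] tells whether the loop at [v] is added, so that all terms
    with the vertex [v] kept have the same form. *)
Definition loop_rel (V : eqType) (v : V) (a : bool) (r : rel V) : rel V :=
  fun x y => r x y || [&& x == v, y == v & a].

Section Glue.
Variables (R : realType) (V : finType) (v : V).
Variables (ev od ev1 od1 ev2 od2 : rel V).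
Hypothesis evE : forall x y, ev x y = ev1 x y || ev2 x y.
Hypothesis odE : forall x y, od x y = od1 x y || od2 x y.
Local Notation attained := (@attained R V).

(** The part of the entry at [v] due to the added loops can be split off. *)
Lemma realizes_unloop a b (e o : rel V) (f : V -> V -> R) :
  realizes (loop_rel v a e) (loop_rel v b o) f ->
  exists2 c : R, fits a b c &
    realizes e o (fun x y => f x y - (x == v)%:R * (y == v)%:R * c).
Proof.
move=> [sf ff]; have := ff v v; rewrite /loop_rel eqxx /=.
case/fits_split => s [t [fE fs ft]]; exists t => //; split=> [x y|x y].
  by rewrite sf [(x == v)%:R * _]mulrC.
have [->|xv] := eqVneq x v; have [->|yv] := eqVneq y v.
- by rewrite !mul1r fE addrK.
- by have := ff v y; rewrite /loop_rel (negbTE yv) /= andbF !orbF mulr0 mul0r subr0.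
- by have := ff x v; rewrite /loop_rel (negbTE xv) /= !orbF mul0r mul0r subr0.
- by have := ff x y; rewrite /loop_rel (negbTE xv) /= !orbF mul0r mul0r subr0.
Qed.

(** With [a] and [b] false no loop is added, and the remaining two cases are the
    terms with an even loop on one side and an odd loop on the other; there the
    loop contributions [c1] and [c2] have opposite signs, so that [c1 + k c2]
    vanishes for some positive [k]. *)
Lemma glue_attained a b p q : ~~ (a && b) ->
  attained (loop_rel v a ev1) (loop_rel v b od1) p ->
  attained (loop_rel v b ev2) (loop_rel v a od2) q ->
  exists2 r, attained ev od r & le2 r (add2 p q).
Proof.
move=> ab [f1 r1 <-] [f2 r2 <-].
have [[sf1 _] [sf2 _]] := (r1, r2).
have [c1 fc1 rg1] := realizes_unloop r1.
have [c2 fc2 rg2] := realizes_unloop r2.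
have [k k0 kE] : exists2 k, 0 < k & c1 + k * c2 = 0.
  have [c20|c20] := eqVneq c2 0.
    exists 1; rewrite ?ltr01 // c20 mulr0 addr0.
    move: fc1 fc2 ab; rewrite c20 /fits.
    by case: (a); case: (b); rewrite ?ltxx //= => /eqP.
  exists (- c1 / c2); last by rewrite mulfVK // subrr.
  move: fc1 fc2 ab c20; rewrite /fits; case: (a); case: (b) => //=.
  - by move=> c1n c2p _ _; rewrite divr_gt0 // oppr_gt0.
  - by move=> c1p c2n _ _; rewrite mulNr -mulrN -invrN divr_gt0 // oppr_gt0.
  - by move=> _ ->.
have [sg gg] := realizes_add rg1 (realizes_scale k0 rg2).
exists (pin (form_mx (fun x y => f1 x y + k * f2 x y))).
  eexists; last by [].
  split=> [x y|x y]; first by rewrite sf1 sf2.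
  have := gg x y; rewrite -evE -odE mulrBr.
  set g := (X in fits _ _ X) => fg.
  suff -> : f1 x y + k * f2 x y = g by [].
  rewrite /g; apply/eqP; rewrite -subr_eq0; apply/eqP.
  transitivity ((x == v)%:R * (y == v)%:R * (c1 + k * c2)); first by ring.
  by rewrite kE mulr0.
rewrite form_mxD form_mxZ.
apply: le2_trans (pin_add _ _) (le2_add (le2_refl _) (pin_scale _ k0));
  by rewrite ?linearZ /= form_mx_sym.
Qed.

Hypothesis ev_sym : forall x y, ev x y = ev y x.
Hypothesis od_sym : forall x y, od x y = od y x.

(** Any entries fitting the edges at [v] may be used as border. *)
Lemma glue_deleted p q :
  attained (del_rel v ev1) (del_rel v od1) p ->
  attained (del_rel v ev2) (del_rel v od2) q ->
  exists2 r, attained ev od r & le2 r (add2 (add2 p q) (1, 1)%N).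
Proof.
move=> [f1 [sf1 ff1] <-] [f2 [sf2 ff2] <-].
pose w x y : R := (od x y)%:R - (ev x y)%:R.
pose b x := if x == v then 0 else w v x.
pose g x y := f1 x y + f2 x y.
have g0 y : g v y = 0.
  have := ff1 v y; have := ff2 v y.
  rewrite /del_rel eqxx /= !andbF /fits => /eqP f2v /eqP f1v.
  by rewrite /g f1v f2v addr0.
have sg x y : g x y = g y x by rewrite /g sf1 sf2.
exists (pin (form_mx (border_form v g b (w v v)))).
  eexists; last by [].
  split=> [x y|x y].
    by rewrite /border_form sg; ring.
  rewrite /border_form; have [->|xv] := eqVneq x v; have [->|yv] := eqVneq y v.
  - rewrite g0 /b eqxx mulr0 mul0r !add0r mulr1 mulr1; exact: fits_witness.
  - rewrite g0 /b eqxx (negbTE yv) !(mulr0, mul0r, mul1r, add0r, addr0).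
    exact: fits_witness.
  - rewrite sg g0 /b eqxx (negbTE xv) !(mulr0, mul0r, mulr1, add0r, addr0).
    rewrite ev_sym od_sym; exact: fits_witness.
  - rewrite !(mulr0, mul0r, addr0) evE odE.
    have := fits_add (ff1 x y) (ff2 x y).
    by rewrite /del_rel xv yv !andbT.
rewrite border_formE; apply: le2_trans (pin_border_le _ _ _ _) _.
  exact: form_mx_sym.
by apply: le2_add (le2_refl _); rewrite form_mxD; apply: pin_add; apply: form_mx_sym.
Qed.
End Glue.

(** * Splitting a form at a vertex *)

Definition supported (V : finType) (S : {set V}) (r : rel V) :=
  forall x y, r x y -> x \in S /\ y \in S.

Definition restr_form (R : realType) (V : finType) (T : {set V})
  (f : V -> V -> R) x y := if (x \in T) && (y \in T) then f x y else 0.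

Definition row_on (R : realType) (V : finType) (T : {set V}) (v : V)
  (f : V -> V -> R) x := if x \in T then f v x else 0.

(** One side of the separation. The hypotheses are not symmetric in the two
    sides, so the results apply to either of them by exchanging roles. *)
Section Piece.
Variables (R : realType) (V : finType) (v : V).
Variables (S1 S2 : {set V}) (ev od ev1 od1 ev2 od2 : rel V).
Hypothesis evE : forall x y, ev x y = ev1 x y || ev2 x y.
Hypothesis odE : forall x y, od x y = od1 x y || od2 x y.
Hypotheses (sev1 : supported S1 ev1) (sod1 : supported S1 od1).
Hypotheses (sev2 : supported S2 ev2) (sod2 : supported S2 od2).
Hypothesis meet : forall x, x \in S1 -> x \in S2 -> x = v.
Hypothesis vS1 : v \in S1.
Variable f : V -> V -> R.
Hypothesis rf : realizes ev od f.
Local Notation T1 := (S1 :\ v).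

Lemma supportedN (S : {set V}) (r : rel V) x y :
  supported S r -> ~~ ((x \in S) && (y \in S)) -> r x y = false.
Proof. by move=> sr n; apply/negP => /sr[xS yS]; rewrite xS yS in n. Qed.

Lemma fits_piece x y : x \in S1 -> y \in S1 -> (x != v) || (y != v) ->
  fits (ev1 x y) (od1 x y) (f x y).
Proof.
move=> x1 y1 xy; have := rf.2 x y; rewrite evE odE.
have n2 : ~~ ((x \in S2) && (y \in S2)).
  apply/negP => /andP[/(meet x1) xv /(meet y1) yv].
  by rewrite xv yv eqxx in xy.
by rewrite (supportedN sev2 n2) (supportedN sod2 n2) !orbF.
Qed.

Lemma realizes_restr :
  realizes (del_rel v ev1) (del_rel v od1) (restr_form T1 f).
Proof.
split=> x y; first by rewrite /restr_form andbC rf.1.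
rewrite /restr_form /del_rel !inE; have [xv|xv] := boolP (x == v).
  by rewrite /= !andbF /fits.
have [yv|yv] := boolP (y == v); first by rewrite /= !andbF /fits.
rewrite /= !andbT; case: ifPn => [/andP[x1 y1]|n1].
  by apply: fits_piece => //; rewrite xv.
by rewrite (supportedN sev1 n1) (supportedN sod1 n1) /fits.
Qed.

Lemma realizes_border_restr a b c :
  fits (ev1 v v || a) (od1 v v || b) c ->
  realizes (loop_rel v a ev1) (loop_rel v b od1)
    (border_form v (restr_form T1 f) (row_on T1 v f) c).
Proof.
have [sg gg] := realizes_restr.
have g0 y : restr_form T1 f v y = 0 by rewrite /restr_form !inE eqxx.
have b0 : row_on T1 v f v = 0 by rewrite /row_on !inE eqxx.
have sf := rf.1.
have fb y : y != v -> fits (ev1 v y) (od1 v y) (row_on T1 v f y).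
  move=> yv; rewrite /row_on !inE yv /=; case: ifPn => [y1|y1].
    by apply: fits_piece => //; rewrite yv orbT.
  have n1 : ~~ ((v \in S1) && (y \in S1)) by rewrite negb_and y1 orbT.
  by rewrite (supportedN sev1 n1) (supportedN sod1 n1) /fits.
have fb' y : y != v -> fits (ev1 y v) (od1 y v) (row_on T1 v f y).
  move=> yv; rewrite /row_on !inE yv /=; case: ifPn => [y1|y1].
    by rewrite sf; apply: fits_piece => //; rewrite yv.
  have n1 : ~~ ((y \in S1) && (v \in S1)) by rewrite negb_and y1.
  by rewrite (supportedN sev1 n1) (supportedN sod1 n1) /fits.
move=> fc; split=> [x y|x y]; first by rewrite /border_form sg; ring.
rewrite /border_form /loop_rel; have [->|xv] := eqVneq x v; have [->|yv] := eqVneq y v.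
- by rewrite g0 b0 !(mulr0, mul0r, mulr1, add0r, addr0).
- by rewrite g0 b0 /= !orbF !(mulr0, mul0r, mul1r, add0r, addr0) fb.
- by rewrite sg g0 b0 /= !orbF !(mulr0, mul0r, mulr1, add0r, addr0) fb'.
- rewrite /= !orbF !(mulr0, mul0r, addr0).
  by have := gg x y; rewrite /del_rel xv yv !andbT.
Qed.

End Piece.

Section Split.
Variables (R : realType) (V : finType) (v : V).
Variables (S1 S2 : {set V}) (ev od ev1 od1 ev2 od2 : rel V).
Hypothesis evE : forall x y, ev x y = ev1 x y || ev2 x y.
Hypothesis odE : forall x y, od x y = od1 x y || od2 x y.
Hypotheses (sev1 : supported S1 ev1) (sod1 : supported S1 od1).
Hypotheses (sev2 : supported S2 ev2) (sod2 : supported S2 od2).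
Hypothesis meet : forall x, x \in S1 -> x \in S2 -> x = v.
Hypotheses (vS1 : v \in S1) (vS2 : v \in S2).
Local Notation T1 := (S1 :\ v).
Local Notation T2 := (S2 :\ v).
Local Notation attained := (@attained R V).

Lemma border_form_split (f : V -> V -> R) : realizes ev od f -> forall x y,
  f x y = border_form v (fun x y => restr_form T1 f x y + restr_form T2 f x y)
    (fun x => row_on T1 v f x + row_on T2 v f x) (f v v) x y.
Proof.
move=> [sf ff].
have disj x : x != v -> ~~ ((x \in S1) && (x \in S2)).
  by move=> xv; apply/negP => /andP[x1 /(meet x1) E]; rewrite E eqxx in xv.
have f0 x y : ~~ ((x \in S1) && (y \in S1)) -> ~~ ((x \in S2) && (y \in S2)) ->
    f x y = 0.
  move=> n1 n2; have := ff x y; rewrite evE odE.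
  rewrite (supportedN sev1 n1) (supportedN sod1 n1).
  by rewrite (supportedN sev2 n2) (supportedN sod2 n2) => /eqP.
have fv y : y != v -> row_on T1 v f y + row_on T2 v f y = f v y.
  move=> yv; rewrite /row_on !inE yv /=; move: (disj y yv) (f0 v y).
  rewrite vS1 vS2 /=; case: (y \in S1); case: (y \in S2) => //= _ f0v.
  - by rewrite addr0.
  - by rewrite add0r.
  - by rewrite f0v // addr0.
have rv T y : restr_form (T :\ v) f v y = 0 by rewrite /restr_form !inE eqxx.
have rv' T y : restr_form (T :\ v) f y v = 0.
  by rewrite /restr_form !inE eqxx andbF.
have bv T : row_on (T :\ v) v f v = 0 by rewrite /row_on !inE eqxx.
move=> x y; rewrite /border_form.
have [->|xv] := eqVneq x v; have [->|yv] := eqVneq y v.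
- by rewrite !rv !bv !(mulr0, mulr1, add0r).
- by rewrite !rv (fv y yv) !bv !(mulr0, mul0r, mul1r, add0r, addr0).
- by rewrite !rv' (fv x xv) sf !(mulr0, mul0r, mulr1, add0r, addr0).
rewrite /restr_form !inE xv yv /= !(mulr0, mul0r, addr0).
move: (disj x xv) (disj y yv) (f0 x y).
by case: (x \in S1); case: (x \in S2); case: (y \in S1); case: (y \in S2) => //=;
  rewrite ?addr0 ?add0r // => _ _ ->.
Qed.

(** The alternative is whether the row [b] of [v] lies in the row space of the
    form [A] on the other vertices. *)
Lemma split_attained p : attained ev od p ->
  (exists p1 p2, [/\ attained (del_rel v ev1) (del_rel v od1) p1,
     attained (del_rel v ev2) (del_rel v od2) p2 &
     le2 (add2 (add2 p1 p2) (1, 1)%N) p]) \/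
  (exists a b p1 p2, [/\ ~~ (a && b),
     attained (loop_rel v a ev1) (loop_rel v b od1) p1,
     attained (loop_rel v b ev2) (loop_rel v a od2) p2 &
     le2 (add2 p1 p2) p]).
Proof.
move=> [f rf <-]; have [sf ff] := rf.
have evE' x y : ev x y = ev2 x y || ev1 x y by rewrite evE orbC.
have odE' x y : od x y = od2 x y || od1 x y by rewrite odE orbC.
have meet' x : x \in S2 -> x \in S1 -> x = v by move=> x2 x1; apply: meet.
have rf1 := realizes_restr evE odE sev1 sod1 sev2 sod2 meet rf.
have rf2 := realizes_restr evE' odE' sev2 sod2 sev1 sod1 meet' rf.
pose F1 := form_mx (restr_form T1 f); pose F2 := form_mx (restr_form T2 f).
pose b1 := vec_row (row_on T1 v f); pose b2 := vec_row (row_on T2 v f).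
pose e : 'rV[R]_#|V| := vec_row (fun x => (x == v)%:R).
pose A := F1 + F2; pose b := b1 + b2.
have sF1 : F1^T = F1 by apply: form_mx_sym rf1.1.
have sF2 : F2^T = F2 by apply: form_mx_sym rf2.1.
have sA : A^T = A by rewrite raddfD /= sF1 sF2.
have FE : form_mx f = border A e b (f v v).
  rewrite (eq_form_mx (border_form_split rf)) border_formE form_mxD.
  by congr border; apply/rowP => i; rewrite !mxE.
have ee : e *m e^T = 1%:M.
  rewrite vec_row_dot (bigD1 v) //= eqxx mulr1 big1 ?addr0 // => x /negbTE->.
  by rewrite mulr0.
have eF T : e *m form_mx (restr_form (T :\ v) f) = 0.
  apply: vec_row_mul0 => x y; rewrite /restr_form !inE.
  by case: eqP; rewrite ?mulr0 ?mul0r.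
have eA : e *m A = 0 by rewrite mulmxDr !eF addr0.
have be : b *m e^T = 0.
  have bTe T : vec_row (row_on (T :\ v) v f) *m e^T = 0.
    rewrite vec_row_dot big1 ?raddf0 // => x _; rewrite /row_on !inE.
    by case: eqP; rewrite ?mulr0 ?mul0r.
  by rewrite mulmxDl !bTe addr0.
pose ind (T : {set V}) : 'M[R]_#|V| := diag_mx (vec_row (fun x => (x \in T)%:R)).
have indT T : (ind T)^T = ind T by rewrite tr_diag_mx.
have T12 x : x \in T1 -> x \in T2 -> False.
  by rewrite !inE => /andP[/eqP xv x1] /andP[_ /(meet x1)].
have cut1 : (A *m ind T1 = F1) /\ (b *m ind T1 = b1).
  split; apply/matrixP => i j; rewrite mul_mx_diag !mxE /restr_form /row_on;
  case: (boolP (enum_val j \in T1)) => j1; rewrite ?andbF ?mulr0 ?mulr1 //;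
  case: (boolP (enum_val j \in T2)) => j2; rewrite ?andbF ?addr0 //;
  by case: (T12 _ j1 j2).
have cut2 : (A *m ind T2 = F2) /\ (b *m ind T2 = b2).
  split; apply/matrixP => i j; rewrite mul_mx_diag !mxE /restr_form /row_on;
  case: (boolP (enum_val j \in T2)) => j2; rewrite ?andbF ?mulr0 ?mulr1 //;
  case: (boolP (enum_val j \in T1)) => j1; rewrite ?andbF ?add0r //;
  by case: (T12 _ j1 j2).
have [cA1 cb1] := cut1; have [cA2 cb2] := cut2.
have pinA : le2 (add2 (pin F1) (pin F2)) (pin A).
  have c11 : ind T1 *m A *m (ind T1)^T = F1.
    rewrite indT -mulmxA cA1; apply/matrixP => i j.
    rewrite mul_diag_mx !mxE /restr_form.
    by case: (_ \in T1); rewrite ?mul1r ?mul0r.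
  have c22 : ind T2 *m A *m (ind T2)^T = F2.
    rewrite indT -mulmxA cA2; apply/matrixP => i j.
    rewrite mul_diag_mx !mxE /restr_form.
    by case: (_ \in T2); rewrite ?mul1r ?mul0r.
  have c12 : ind T1 *m A *m (ind T2)^T = 0.
    rewrite indT -mulmxA cA2; apply/matrixP => i j.
    rewrite mul_diag_mx !mxE /restr_form.
    case: (boolP (enum_val i \in T1)) => i1; rewrite ?mul1r ?mul0r //.
    by case: (boolP (enum_val i \in T2)) => // /(T12 _ i1).
  by have := pin_orthogonal sA c12; rewrite c11 c22.
(* Outside the row space, the two pieces with [v] deleted are the witnesses. *)
have [/submxP[x bE]|bA] := boolP (b <= A)%MS; last first.
  left; exists (pin F1), (pin F2); split; first by eexists; first exact: rf1.
    by eexists; first exact: rf2.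
  rewrite FE; apply: le2_trans (pin_border_nrange_ge _ sA ee eA be bA).
  exact: le2_add (le2_refl _).
right.
have bE1 : b1 = x *m F1 by rewrite -cb1 bE -mulmxA cA1.
have bE2 : b2 = x *m F2 by rewrite -cb2 bE -mulmxA cA2.
have [d1 [d2 [dE fd1 fd2]]] : exists s t,
    [/\ f v v = s + t, fits (ev1 v v) (od1 v v) s & fits (ev2 v v) (od2 v v) t].
  by apply: fits_split; rewrite -evE -odE.
(* With the entry [d1 - c = s1] the first Schur complement is [0], and with
   [d2 + c] the second one is the Schur complement of the whole form. *)
pose s1 := (b1 *m x^T) 0 0; pose s2 := (b2 *m x^T) 0 0; pose c := d1 - s1.
have fitsc (z : R) : fits (z < 0) (0 < z) z.
  by rewrite /fits; case: ltgtP.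
have fc1 : fits (ev1 v v || (0 < c)) (od1 v v || (c < 0)) (d1 - c).
  by apply: fits_add => //; have := fitsc (- c); rewrite oppr_lt0 oppr_gt0.
have fc2 : fits (ev2 v v || (c < 0)) (od2 v v || (0 < c)) (d2 + c).
  exact: fits_add.
have r1 := realizes_border_restr evE odE sev1 sod1 sev2 sod2 meet vS1 rf fc1.
have r2 := realizes_border_restr evE' odE' sev2 sod2 sev1 sod1 meet' vS2 rf fc2.
exists (0 < c), (c < 0), (pin (border F1 e b1 (d1 - c))),
  (pin (border F2 e b2 (d2 + c))); split; last 1 first.
- rewrite FE; apply: le2_trans (pin_border_range_ge _ sA ee eA be bE).
  apply: le2_trans (le2_add pinA (le2_refl _)).
  have -> : f v v - (b *m x^T) 0 0 = (d2 + c) - s2.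
    by rewrite dE /b mulmxDl mxE -/s1 -/s2 /c; ring.
  rewrite -add2A; apply: le2_add.
    have := pin_border_range_le e (d1 - c) sF1 bE1.
    have -> : d1 - c - (b1 *m x^T) 0 0 = 0 by rewrite -/s1 /c; ring.
    by rewrite raddf0 pin0 /add2 !addn0 -surjective_pairing.
  exact: (pin_border_range_le e (d2 + c) sF2 bE2).
- by case: ltgtP.
- eexists; first exact: r1.
  by rewrite border_formE.
- eexists; first exact: r2.
  by rewrite border_formE.
Qed.

End Split.

(** * Adjacency in signed graphs *)

Section Graphs.
Variables (R : realType) (V E : finType).
Implicit Types (G : sgraph V E) (x y v : V) (f : V -> V -> R).

Lemma adjE G x y : adj G x y = even_adj G x y || odd_adj G x y.
Proof.
apply/existsP/orP => [[e c]|[]/existsP[e /andP[_ c]]]; try by exists e.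
have eG : e \in edges G by case/andP: c.
by case: (boolP (e \in oddE G)) => eo; [right | left]; apply/existsP; exists e;
  rewrite ?inE eo ?eG.
Qed.

Lemma adj_verts G x y : adj G x y -> x \in verts G /\ y \in verts G.
Proof.
move=> /existsP[e /andP[eG /eqP ee]].
have /andP[/fintype.subsetP sub _] := endsP eG.
by split; apply: sub; rewrite ee !inE eqxx ?orbT.
Qed.

Lemma even_adj_sym G x y : even_adj G x y = even_adj G y x.
Proof. by apply: eq_existsb => e; rewrite /connects finset.setUC. Qed.

Lemma odd_adj_sym G x y : odd_adj G x y = odd_adj G y x.
Proof. by apply: eq_existsb => e; rewrite /connects finset.setUC. Qed.

Lemma fitsP G x y (r : R) :
  reflect [/\ r < 0 -> even_adj G x y, r > 0 -> odd_adj G x y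
     & r = 0 -> (even_adj G x y /\ odd_adj G x y) \/ ~~ adj G x y]
    (fits (even_adj G x y) (odd_adj G x y) r).
Proof.
rewrite adjE /fits; case: even_adj => //; case: odd_adj => //=; apply: (iffP idP).
- by move=> _; split=> //; left.
- by [].
- by move=> r0; split=> // [|/eqP]; [rewrite ltNge (ltW r0)|rewrite lt_eqF].
- by case=> _ r1 r2; case: (ltgtP r 0) => [//|/r1//|/r2[[]|]//].
- by move=> r0; split=> // [|/eqP]; [rewrite ltNge (ltW r0)|rewrite gt_eqF].
- by case=> r1 _ r2; case: (ltgtP r 0) => [/r1//|//|/r2[[]|]//].
- by move=> /eqP->; rewrite ltxx; split=> //; right.
- by case=> r1 r2 _; case: (ltgtP r 0) => [/r1//|/r2//|//].
Qed.

Lemma inertia_setP G p : inertia_set R G p <->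
  exists2 f : V -> V -> R,
    realizes (even_adj G) (odd_adj G) f & pin (form_mx f) = p.
Proof.
split=> [[A [sA cA] <-]|[f [sf ff] <-]].
  pose f x y := \sum_i (x == enum_val i)%:R *
     \sum_j (y == enum_val j)%:R * A i j.
  have sf x y : f x y = f y x.
    rewrite /f; under eq_bigr => i _ do rewrite big_distrr /=.
    rewrite exchange_big /=; apply: eq_bigr => j _.
    rewrite big_distrr /=; apply: eq_bigr => i _.
    by rewrite mulrCA -[in LHS]sA mxE.
  have fA i j : f (enum_val i) (enum_val j) = A i j.
    by rewrite /f sum_delta_ord sum_delta_ord.
  have f0 x y : x \notin verts G -> f x y = 0.
    move=> xG; rewrite /f big1 // => i _; case: eqP => [xi|]; last by rewrite mul0r.
    by rewrite xi enum_valP in xG.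
  exists f; last first.
    by rewrite -(pin_form_mx sf f0); congr pin;
      apply/matrixP => i j; rewrite mxE.
  split=> // x y; apply/fitsP.
  have nadj z t : z \notin verts G \/ t \notin verts G ->
      fits (even_adj G z t) (odd_adj G z t) (f z t).
    move=> zt; have : ~~ adj G z t.
      by apply/negP => /adj_verts[zG tG]; case: zt => /negP.
    rewrite adjE negb_or => /andP[/negbTE-> /negbTE->].
    by case: zt => [/f0->|/f0 zt]; rewrite /fits //= sf zt.
  have [xG|xG] := boolP (x \in verts G); last by apply/fitsP/nadj; left.
  have [yG|yG] := boolP (y \in verts G); last by apply/fitsP/nadj; right.
  have := cA (enum_rank_in xG x) (enum_rank_in xG y).
  by rewrite -fA !enum_rankK_in.
exists (\matrix_(i, j) f (enum_val i) (enum_val j)).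
  split; first by apply/matrixP => i j; rewrite !mxE sf.
  by move=> i j; rewrite !mxE; apply/fitsP.
apply: pin_form_mx => // x y xG; have := ff x y; rewrite /fits.
have : ~~ adj G x y by apply: contra xG => /adj_verts[].
by rewrite adjE negb_or => /andP[/negbTE-> /negbTE->] /eqP.
Qed.

End Graphs.

Section Adjacency.
Variables (V E : finType).
Implicit Types (G : sgraph V E) (x y v : V).

Lemma even_adj_del G v : even_adj (del_vertex G v) =2 del_rel v (even_adj G).
Proof.
move=> x y; apply/existsP/and3P => [[e]|[/existsP[e]]].
  rewrite /connects !inE /= => /andP[/andP[eo /andP[eG ve]]].
  move=> /andP[_ /eqP ee]; move: eo; rewrite eG ve !andbT => eo.
  move: ve; rewrite ee !inE negb_or ![v == _]eq_sym => /andP[xv yv]; split=> //.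
  by apply/existsP; exists e; rewrite !inE eo eG /connects eG ee eqxx.
rewrite /connects !inE => /andP[/andP[eo eG] /andP[_ ee]] xv yv; exists e.
have ve : v \notin ends G e.
  by rewrite (eqP ee) !inE negb_or ![v == _]eq_sym xv.
by rewrite /connects !inE /= eG ve ee (negbTE eo).
Qed.

Lemma odd_adj_del G v : odd_adj (del_vertex G v) =2 del_rel v (odd_adj G).
Proof.
move=> x y; apply/existsP/and3P => [[e]|[/existsP[e]]].
  rewrite /connects !inE /= => /andP[/andP[eo /andP[eG ve]]].
  move=> /andP[_ /eqP ee].
  move: ve; rewrite ee !inE negb_or ![v == _]eq_sym => /andP[xv yv]; split=> //.
  by apply/existsP; exists e; rewrite eo /connects eG ee eqxx.
rewrite /connects => /andP[eo /andP[eG ee]] xv yv; exists e.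
have ve : v \notin ends G e.
  by rewrite (eqP ee) !inE negb_or ![v == _]eq_sym xv.
by rewrite /connects !inE /= eG ve ee eo.
Qed.

Lemma set1_eq_set2 v x y : ([set v] == [set x; y]) = (x == v) && (y == v).
Proof.
apply/eqP/andP => [E1|[/eqP-> /eqP->]]; last by rewrite finset.setUid.
have : x \in [set v] by rewrite E1 !inE eqxx.
have : y \in [set v] by rewrite E1 !inE eqxx orbT.
by rewrite !inE.
Qed.

Lemma mem_Some (S : {set E}) (e : E) :
  (Some e \in [set Some e' | e' in S]) = (e \in S).
Proof. by rewrite mem_imset //; apply: Some_inj. Qed.

Lemma None_notin (S : {set E}) : (None \in [set Some e' | e' in S]) = false.
Proof. by apply/negbTE/imsetP => -[]. Qed.

Lemma connects_add_loop G v (e : option E) x y :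
  connects (add_loop_ground G v) e x y =
  if e is Some e' then connects G e' x y else (x == v) && (y == v).
Proof.
by case: e => [e|]; rewrite /connects /= !inE ?mem_Some ?set1_eq_set2 //=.
Qed.

Lemma existsb_option (P : pred (option E)) :
  [exists e, P e] = P None || [exists e, P (Some e)].
Proof.
apply/existsP/orP => [[[e|] Pe]|[Pe|/existsP[e Pe]]];
  try by [left|eexists; exact: Pe].
by right; apply/existsP; exists e.
Qed.

Lemma even_adj_even_loop G v :
  even_adj (add_even_loop G v) =2 loop_rel v true (even_adj G).
Proof.
move=> x y; rewrite /even_adj /loop_rel andbT existsb_option orbC.
rewrite connects_add_loop /evenE /= !inE None_notin /=; congr (_ || _).
by apply: eq_existsb => e; rewrite connects_add_loop !inE /= !mem_Some.
Qed.

Lemma odd_adj_even_loop G v :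
  odd_adj (add_even_loop G v) =2 loop_rel v false (odd_adj G).
Proof.
move=> x y; rewrite /odd_adj /loop_rel !andbF orbF existsb_option.
rewrite /= None_notin /=.
by apply: eq_existsb => e; rewrite connects_add_loop mem_Some.
Qed.

Lemma odd_adj_odd_loop G v :
  odd_adj (add_odd_loop G v) =2 loop_rel v true (odd_adj G).
Proof.
move=> x y; rewrite /odd_adj /loop_rel andbT existsb_option orbC.
rewrite connects_add_loop /= !inE /=; congr (_ || _).
by apply: eq_existsb => e; rewrite connects_add_loop !inE /= mem_Some.
Qed.

Lemma even_adj_odd_loop G v :
  even_adj (add_odd_loop G v) =2 loop_rel v false (even_adj G).
Proof.
move=> x y; rewrite /even_adj /loop_rel !andbF orbF existsb_option.
rewrite /evenE /= !inE /=.
by apply: eq_existsb => e; rewrite connects_add_loop !inE /= !mem_Some.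
Qed.

Lemma loop_rel_false v (r : rel V) : loop_rel v false r =2 r.
Proof. by move=> x y; rewrite /loop_rel !andbF orbF. Qed.

Variables (k : nat) (G G1 G2 : sgraph V E).
Hypothesis sep : signed_k_separation k G G1 G2.

Lemma connects_separation e x y :
  (e \in edges G1 -> connects G1 e x y = connects G e x y) /\
  (e \in edges G2 -> connects G2 e x y = connects G e x y).
Proof.
have [[[[_ _ en1] [_ _ en2] _ eU _] _] _ _] := sep.
by split=> eG; rewrite /connects -eU inE eG ?orbT (en1, en2).
Qed.

Lemma separation_adj (O O1 O2 : {set E}) x y :
  O \subset edges G -> O1 = O :&: edges G1 -> O2 = O :&: edges G2 ->
  [exists e in O, connects G e x y] =
  [exists e in O1, connects G1 e x y] || [exists e in O2, connects G2 e x y].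
Proof.
move=> /fintype.subsetP sO -> ->; have [[[_ _ _ eU _] _] _ _] := sep.
apply/existsP/orP => [[e /andP[eO c]]|[]/existsP[e]].
- have [c1 c2] := connects_separation e x y.
  move: (sO e eO); rewrite -eU inE => /orP[eG|eG]; [left|right];
  by apply/existsP; exists e; rewrite inE eO eG (c1, c2).
- move=> /andP[]; rewrite inE => /andP[eO eG] c; exists e.
  by rewrite eO -(connects_separation e x y).1.
- move=> /andP[]; rewrite inE => /andP[eO eG] c; exists e.
  by rewrite eO -(connects_separation e x y).2.
Qed.

Lemma separation_odd_adj x y :
  odd_adj G x y = odd_adj G1 x y || odd_adj G2 x y.
Proof. by case: sep => _ o1 o2; apply: separation_adj => //; apply: oddE_sub. Qed.

Lemma separation_even_adj x y :
  even_adj G x y = even_adj G1 x y || even_adj G2 x y.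
Proof.
have [[[_ _ _ eU _] _] o1 o2] := sep.
apply: separation_adj; first exact: subsetDl.
  apply/setP => e; rewrite /evenE o1 !inE -eU inE.
  by case: (e \in oddE G); case: (e \in edges G1); rewrite ?andbF.
apply/setP => e; rewrite /evenE o2 !inE -eU inE.
by case: (e \in oddE G); case: (e \in edges G2); rewrite ?orbT ?andbF.
Qed.

End Adjacency.

Lemma inertia_set_attained (R : realType) (V E : finType) (G : sgraph V E)
    (ev od : rel V) p :
  even_adj G =2 ev -> odd_adj G =2 od ->
  inertia_set R G p <-> attained R ev od p.
Proof.
move=> evE odE; apply: (iff_trans (inertia_setP R G p)).
exact: attained_ext.
Qed.

Theorem mainTheorem1 (R : realType) (V E : finType) (G G1 G2 : sgraph V E)
    (v : V) :
  signed_k_separation 1 G G1 G2 ->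
  v \in verts G1 :&: verts G2 ->
  (inertia_set R G ~=
     (inertia_set R (del_vertex G1 v) + inertia_set R (del_vertex G2 v)
        + [set (1, 1)%N]%classic)
     `|` (inertia_set R G1 + inertia_set R G2)
     `|` (inertia_set R (add_even_loop G1 v) + inertia_set R (add_odd_loop G2 v))
     `|` (inertia_set R (add_odd_loop G1 v) + inertia_set R (add_even_loop G2 v))
  )%pairs.
Proof.
move=> sep; rewrite inE => /andP[vG1 vG2].
have evE := separation_even_adj sep.
have odE := separation_odd_adj sep.
have meet x : x \in verts G1 -> x \in verts G2 -> x = v.
  move=> x1 x2; case: sep => -[_ /eqP/cards1P[u uE]] _ _.
  have : x \in verts G1 :&: verts G2 by rewrite inE x1.
  have : v \in verts G1 :&: verts G2 by rewrite inE vG1.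
  by rewrite uE !inE => /eqP-> /eqP->.
have supE (K : sgraph V E) : supported (verts K) (even_adj K).
  by move=> x y xy; apply: adj_verts; rewrite adjE xy.
have supO (K : sgraph V E) : supported (verts K) (odd_adj K).
  by move=> x y xy; apply: adj_verts; rewrite adjE xy orbT.
have inertE p : inertia_set R G p <-> attained R (even_adj G) (odd_adj G) p.
  exact: inertia_set_attained.
have delE K p := inertia_set_attained R p (even_adj_del K v) (odd_adj_del K v).
have plainE K p := inertia_set_attained R p
  (fun x y => esym (loop_rel_false v (@even_adj V E K) x y))
  (fun x y => esym (loop_rel_false v (@odd_adj V E K) x y)).
have evenlE K p := inertia_set_attained R p
  (even_adj_even_loop K v) (odd_adj_even_loop K v).
have oddlE K p := inertia_set_attained R p
  (even_adj_odd_loop K v) (odd_adj_odd_loop K v).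
have lift p : (exists2 r, attained R (even_adj G) (odd_adj G) r & le2 r p) ->
    exists2 r, inertia_set R G r & (r.1 <= p.1)%N /\ (r.2 <= p.2)%N.
  by case=> r /inertE Gr /andP le; exists r.
split=> p.
  case=> [[[]|]|].
  - case=> _ [p1 /delE P1] [p2 /delE P2] <- [_ ->] <-.
    apply: lift.
    have ev_sym x y := even_adj_sym G x y.
    have od_sym x y := odd_adj_sym G x y.
    exact: (glue_deleted evE odE ev_sym od_sym P1 P2).
  - case=> p1 /plainE P1 [p2 /plainE P2] <-; apply: lift.
    exact: (glue_attained evE odE _ P1 P2).
  - case=> p1 /evenlE P1 [p2 /oddlE P2] <-; apply: lift.
    exact: (glue_attained evE odE _ P1 P2).
  - case=> p1 /oddlE P1 [p2 /evenlE P2] <-; apply: lift.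
    exact: (glue_attained evE odE _ P1 P2).
move=> /inertE /(split_attained evE odE (supE G1) (supO G1) (supE G2) (supO G2)
  meet vG1 vG2) [].
  move=> [p1 [p2 [/delE P1 /delE P2 /andP le]]].
  exists (add2 (add2 p1 p2) (1, 1)%N) => //; left; left; left.
  by exists (add2 p1 p2); [exists p1 => //; exists p2|exists (1, 1)%N].
move=> [a [b [p1 [p2 [ab P1 P2 /andP le]]]]]; exists (add2 p1 p2) => //.
case: a b ab P1 P2 => -[] // _ P1 P2.
- by left; right; exists p1; [exact/evenlE|exists p2; first exact/oddlE].
- by right; exists p1; [exact/oddlE|exists p2; first exact/evenlE].
- by left; left; right; exists p1; [exact/plainE|exists p2; first exact/plainE].
Qed.
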